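(* Algorithm SegmentBound (described in the context), run on a time series of $n$ points with error bound $\epsilon$, has time complexity $O(n)$ and space complexity $O(1)$.
   Context: A time series is a sequence of reals $x_1, x_2, \ldots$ arriving one at a time. A line segment is a pair of endpoints $((i,y_i),(j,y_j))$ with integers $i<j$; its range is $[i,j]$, and it approximates $x_k$ ($i\le k\le j$) by $\tilde{x}_k = y_i + \frac{k-i}{j-i}(y_j - y_i)$. For points $x_i,\ldots,x_j$, the least-squares segment is the segment over range $[i,j]$ whose underlying line minimizes $\sum_{k=i}^{j}(x_k - \tilde{x}_k)^2$, and its segment error is this minimum sum. Algorithm SegmentBound with error bound $\epsilon$: set $i=1$, $j=3$, $s = ((1,x_1),(2,x_2))$. Repeat: let $s'$ be the least-squares segment for $x_i,\ldots,x_j$; if $\sum_{k=i}^{j}(x_k-\tilde{x}_k)^2 \le \epsilon$ for $s'$, set $s=s'$ and $j=j+1$; otherwise output $s$, set $i=j$, $j=j+2$, and $s = ((i,x_i),(i+1,x_{i+1}))$. (When the input ends, the current $s$ is output.) Complexity is measured in the standard model in which arithmetic operations and comparisons on reals cost $O(1)$ time and each real occupies $O(1)$ space. *)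

(* Defs.v *)
From Stdlib Require List.
From HB Require Import structures.
From mathcomp Require Import all_boot all_order all_algebra.
From mathcomp Require Import reals.

Set Implicit Arguments.
Unset Strict Implicit.
Unset Printing Implicit Defensive.

Import Order.TTheory GRing.Theory Num.Theory.
Local Open Scope ring_scope.

(** * Segments and least squares *)

Section SegmentBound.
Variable R : realType.

(* The segment ((i, y_i), (j, y_j)). *)
Definition segment : Type := ((nat * R) * (nat * R))%type.

Definition range (s : segment) : nat * nat := (s.1.1, s.2.1).

Definition approx (s : segment) (k : nat) : R :=
  let: ((i, yi), (j, yj)) := s in
  yi + (k%:R - i%:R) / (j%:R - i%:R) * (yj - yi).

(* Time series are numbered from 1: the point x_k is entry k - 1 of the list. *)
Definition point (x : seq R) (k : nat) : R := nth 0 x k.-1.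

Definition sq_error (x : seq R) (s : segment) : R :=
  \sum_((range s).1 <= k < (range s).2.+1) (point x k - approx s k) ^+ 2.

Definition least_squares (x : seq R) (i j : nat) (s : segment) : Prop :=
  [/\ (i < j)%N, range s = (i, j)
    & forall s' : segment, range s' = (i, j) -> sq_error x s <= sq_error x s'].

(** * Algorithm SegmentBound *)

(* The variables of the algorithm when an iteration of "Repeat" begins,
   together with the segments that have been output so far. *)
Record sb_state := SBState {
  sb_i : nat; sb_j : nat; sb_s : segment; sb_out : seq segment }.

Definition two_points (x : seq R) (i : nat) : segment :=
  ((i, point x i), (i.+1, point x i.+1)).

(* [sb_from x eps st tr out]: starting with the state [st], the algorithm goes
   through the states [tr] (the first of which is [st]), and its complete output
   is then [out]. A rejection at the last point x_j of the series restarts with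
   i = j; as x_{i+1} never arrives, there is no new segment s to output. *)
Inductive sb_from (x : seq R) (eps : R) :
    sb_state -> seq sb_state -> seq segment -> Prop :=
| sb_accept i j s o s' tr out :
    (j <= size x)%N -> least_squares x i j s' -> sq_error x s' <= eps ->
    sb_from x eps (SBState i j.+1 s' o) tr out ->
    sb_from x eps (SBState i j s o) (SBState i j s o :: tr) out
| sb_reject i j s o s' tr out :
    (j.+1 <= size x)%N -> least_squares x i j s' -> ~ (sq_error x s' <= eps) ->
    sb_from x eps (SBState j j.+2 (two_points x j) (rcons o s)) tr out ->
    sb_from x eps (SBState i j s o) (SBState i j s o :: tr) out
| sb_reject_last i j s o s' :
    j = size x -> least_squares x i j s' -> ~ (sq_error x s' <= eps) ->
    sb_from x eps (SBState i j s o) [:: SBState i j s o] (rcons o s)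
| sb_end i j s o :
    (size x < j)%N ->
    sb_from x eps (SBState i j s o) [:: SBState i j s o] (rcons o s).

(* With fewer than two points the initial segment never becomes available. *)
Inductive sb_execution (x : seq R) (eps : R) :
    seq sb_state -> seq segment -> Prop :=
| sb_short : (size x < 2)%N -> sb_execution x eps [::] [::]
| sb_start tr out :
    (2 <= size x)%N ->
    sb_from x eps (SBState 1%N 3%N (two_points x 1%N) [::]) tr out ->
    sb_execution x eps tr out.

End SegmentBound.

(** * The real RAM

  Memory cells are indexed by nat and hold one real each. The input arrives on
  a one-way stream, the output leaves on a one-way stream, and neither occupies
  memory. Every instruction costs one unit of time. *)

Inductive instr : Type :=
| Const of nat & int               (* M[a] := z *)
| Copy of nat & nat                (* M[a] := M[b] *)
| LoadInd of nat & nat              (* M[a] := M[M[b]] *)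
| StoreInd of nat & nat            (* M[M[a]] := M[b] *)
| Add of nat & nat & nat           (* M[a] := M[b] + M[c] *)
| Sub of nat & nat & nat
| Mul of nat & nat & nat
| Div of nat & nat & nat           (* stuck if M[c] = 0 *)
| Jump of nat
| JumpLe of nat & nat & nat        (* if M[a] <= M[b] then goto l *)
| Read of nat & nat                (* M[a] := next input; goto l if none is left *)
| Write of nat                     (* output M[a] *)
| Halt.

Definition program : Type := seq instr.

Section RealRAM.
Variable R : realType.

Record config := Config {
  pc : nat; mem : nat -> R; inp : seq R; outp : seq R }.

Definition upd (m : nat -> R) (a : nat) (v : R) : nat -> R :=
  fun b => if b == a then v else m b.

(* A real is usable as an address only if it is a natural number, so that
   indirect addressing does not provide a floor operation. *)
Definition address (r : R) : option nat :=
  if r \is a Num.nat then Some (Num.truncn r) else None.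

Definition initial (eps : R) (x : seq R) : config :=
  Config 0%N (upd (fun=> 0) 0%N eps) x [::].

Definition fetch (P : program) (c : config) : option instr := onth P (pc c).

Definition assign (c : config) (a : nat) (v : R) : config :=
  Config (pc c).+1 (upd (mem c) a v) (inp c) (outp c).

Definition goto (c : config) (l : nat) : config :=
  Config l (mem c) (inp c) (outp c).

(* [None] when the machine has halted or is stuck. *)
Definition step (P : program) (c : config) : option config :=
  let m := mem c in
  if fetch P c is Some ins then
    match ins with
    | Const a z => Some (assign c a z%:~R)
    | Copy a b => Some (assign c a (m b))
    | LoadInd a b => omap (fun k => assign c a (m k)) (address (m b))
    | StoreInd a b => omap (fun k => assign c k (m b)) (address (m a))
    | Add a b d => Some (assign c a (m b + m d))
    | Sub a b d => Some (assign c a (m b - m d))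
    | Mul a b d => Some (assign c a (m b * m d))
    | Div a b d => if m d == 0 then None else Some (assign c a (m b / m d))
    | Jump l => Some (goto c l)
    | JumpLe a b l => Some (goto c (if m a <= m b then l else (pc c).+1))
    | Read a l =>
        if inp c is v :: w then Some (Config (pc c).+1 (upd m a v) w (outp c))
        else Some (goto c l)
    | Write a => Some (Config (pc c).+1 m (inp c) (rcons (outp c) (m a)))
    | Halt => None
    end
  else None.

Definition run (P : program) (eps : R) (x : seq R) (t : nat) : option config :=
  iter t (obind (step P)) (Some (initial eps x)).

Definition halts_at (P : program) (eps : R) (x : seq R) (t : nat) (c : config) :
    Prop :=
  run P eps x t = Some c /\ fetch P c = Some Halt.

Definition accessed (P : program) (c : config) : seq nat :=
  let m := mem c in
  if fetch P c is Some ins then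
    match ins with
    | Const a _ | Read a _ | Write a => [:: a]
    | Copy a b | JumpLe a b _ => [:: a; b]
    | LoadInd a b => [:: a, b & seq_of_opt (address (m b))]
    | StoreInd a b => [:: a, b & seq_of_opt (address (m a))]
    | Add a b d | Sub a b d | Mul a b d | Div a b d => [:: a; b; d]
    | Jump _ | Halt => [::]
    end
  else [::].

(* The number of distinct memory cells accessed during the first t steps. *)
Definition space (P : program) (eps : R) (x : seq R) (t : nat) : nat :=
  size (undup (flatten
    [seq oapp (accessed P) [::] (run P eps x k) | k <- iota 0 t])).

(* Worst case over all series of n points and all error bounds. *)
Definition time_O (P : program) (f : nat -> nat) : Prop :=
  exists C n0 : nat, forall (n : nat) (eps : R) (x : seq R),
    (n0 <= n)%N -> size x = n ->
    exists t c, halts_at P eps x t c /\ (t <= C * f n)%N.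

Definition space_O (P : program) (f : nat -> nat) : Prop :=
  exists C n0 : nat, forall (n : nat) (eps : R) (x : seq R),
    (n0 <= n)%N -> size x = n ->
    exists t c, halts_at P eps x t c /\ (space P eps x t <= C * f n)%N.

(** * Implementations of SegmentBound on the real RAM *)

Definition encode (s : segment R) : seq R :=
  [:: s.1.1%:R; s.1.2; s.2.1%:R; s.2.2].

Definition encode_output (o : seq (segment R)) : seq R :=
  flatten [seq encode s | s <- o].

(* The program point where "Repeat" begins and the cells of i, j and s. *)
Record layout := Layout {
  l_head : nat; l_i : nat; l_j : nat; l_s : 4.-tuple nat }.

Definition represents (L : layout) (c : config) (st : sb_state R) : Prop :=
  [/\ pc c = l_head L,
      mem c (l_i L) = (sb_i st)%:R,
      mem c (l_j L) = (sb_j st)%:R,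
      [seq mem c a | a <- l_s L] = encode (sb_s st)
    & outp c = encode_output (sb_out st)].

(* The program passes, in order and at times ts, through configurations that
   represent the successive states of the algorithm; it then halts having
   written the output of the algorithm. *)
Definition implements_SegmentBound (P : program) : Prop :=
  exists L : layout, forall (x : seq R) (eps : R),
    exists tr out, sb_execution x eps tr out /\
    exists ts t c,
      [/\ sorted ltn ts,
          List.Forall2 (fun u st =>
            exists2 d, run P eps x u = Some d & represents L d st) ts tr,
          halts_at P eps x t c
        & outp c = encode_output out].

End RealRAM.

(* Main.v *)
Require Import Defs.
From mathcomp Require Import all_boot all_order all_algebra.
From mathcomp Require Import reals.
From mathcomp Require Import ring lra zify.

(** The least-squares line through [x_i, ..., x_j] and its error depend on the
  data only through [sum u], [sum u^2], [sum x], [sum u x] and [sum x^2], where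
  [u = k - i].  These five sums are updated in constant time when a point
  arrives, so one iteration of the algorithm takes boundedly many operations on
  a fixed set of cells; every iteration consumes at least one input. *)

Set Implicit Arguments.
Unset Strict Implicit.
Unset Printing Implicit Defensive.

Import Order.TTheory GRing.Theory Num.Theory.
Local Open Scope ring_scope.

(** * Least squares from running sums *)

Section Fit.
Variable R : realType.
Implicit Types (f : nat -> R) (n : nat) (a b : R).

Definition sum_u n : R := \sum_(u < n) u%:R.
Definition sum_uu n : R := \sum_(u < n) (u%:R * u%:R).
Definition sum_y f n : R := \sum_(u < n) f u.
Definition sum_uy f n : R := \sum_(u < n) (u%:R * f u).
Definition sum_yy f n : R := \sum_(u < n) (f u * f u).

Definition residual f n a b : R := \sum_(u < n) (f u - (a + u%:R * b)) ^+ 2.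

(** This is [n^2] times the variance of the offsets [0, ..., n-1]. *)
Definition fit_det n : R := n%:R * sum_uu n - sum_u n * sum_u n.

Definition slope f n : R :=
  (n%:R * sum_uy f n - sum_u n * sum_y f n) / fit_det n.

Definition intercept f n : R := (sum_y f n - slope f n * sum_u n) / n%:R.

Lemma residual_ge0 f n a b : 0 <= residual f n a b.
Proof. by apply: sumr_ge0 => u _; exact: sqr_ge0. Qed.

Lemma residualE f n a b :
  residual f n a b = sum_yy f n - 2 * a * sum_y f n - 2 * b * sum_uy f n
    + n%:R * a ^+ 2 + 2 * a * b * sum_u n + b ^+ 2 * sum_uu n.
Proof.
rewrite /residual /sum_yy /sum_y /sum_uy /sum_u /sum_uu.
elim: n => [|n IHn]; first by rewrite !big_ord0; ring.
by rewrite !big_ord_recr /= IHn -natr1; ring.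
Qed.

Lemma sum_uE n : 2 * sum_u n = n%:R * (n%:R - 1).
Proof.
rewrite /sum_u; elim: n => [|n IHn]; first by rewrite big_ord0; ring.
by rewrite big_ord_recr /= mulrDr IHn -natr1; ring.
Qed.

Lemma sum_uuE n : 6 * sum_uu n = n%:R * (n%:R - 1) * (2 * n%:R - 1).
Proof.
rewrite /sum_uu; elim: n => [|n IHn]; first by rewrite big_ord0; ring.
by rewrite big_ord_recr /= mulrDr IHn -natr1; ring.
Qed.

(** The factor 12 clears denominators; nonvanishing for [1 < n] can then be read off. *)
Lemma fit_detE n : 12 * fit_det n = n%:R ^+ 2 * (n%:R ^+ 2 - 1).
Proof.
have -> : 12 * fit_det n = 2 * n%:R * (6 * sum_uu n) - 3 * (2 * sum_u n) ^+ 2.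
  by rewrite /fit_det; ring.
by rewrite sum_uuE sum_uE; ring.
Qed.

Lemma fit_det_neq0 n : (1 < n)%N -> fit_det n != 0.
Proof.
move=> n_gt1; have : 12 * fit_det n != 0; last first.
  by rewrite mulf_eq0 negb_or => /andP[].
have n_gt1R : 1 < n%:R :> R by rewrite ltr1n.
by rewrite fit_detE; apply: lt0r_neq0; apply: mulr_gt0; nra.
Qed.

(** The normal equations make the quadratic terms of [residualE] linear in [sum_y] and [sum_uy]. The
    right-hand side is what the program leaves in cell 20. *)
Lemma residual_fit f n : (1 < n)%N ->
  residual f n (intercept f n) (slope f n) =
  sum_yy f n - intercept f n * sum_y f n - slope f n * sum_uy f n.
Proof.
move=> n_gt1; have := fit_det_neq0 n_gt1; rewrite residualE /fit_det => D0.
have n0 : n%:R != 0 :> R by rewrite pnatr_eq0; lia.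
by rewrite /intercept /slope /fit_det; field; rewrite D0.
Qed.

Lemma residual_min f n a b : (1 < n)%N ->
  residual f n (intercept f n) (slope f n) <= residual f n a b.
Proof.
move=> n_gt1; rewrite -subr_ge0.
(* By the normal equations the excess is the sum of squares of the difference
   of the two lines. *)
suff -> : residual f n a b - residual f n (intercept f n) (slope f n) =
    residual (fun=> 0) n (a - intercept f n) (b - slope f n).
  exact: residual_ge0.
have z1 : sum_yy (fun=> 0) n = 0.
  by rewrite /sum_yy big1 // => u _; rewrite mulr0.
have z2 : sum_y (fun=> 0) n = 0 by rewrite /sum_y big1.
have z3 : sum_uy (fun=> 0) n = 0.
  by rewrite /sum_uy big1 // => u _; rewrite mulr0.
have := fit_det_neq0 n_gt1; rewrite !residualE z1 z2 z3 /fit_det => D0.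
have n0 : n%:R != 0 :> R by rewrite pnatr_eq0; lia.
by rewrite /intercept /slope /fit_det; field; rewrite D0.
Qed.

Lemma sq_errorE (x : seq R) (i j : nat) (yi yj : R) : (i < j)%N ->
  sq_error x ((i, yi), (j, yj)) =
  residual (fun u => point x (i + u)) (j - i).+1 yi ((yj - yi) / (j - i)%:R).
Proof.
move=> ij; rewrite /sq_error /residual /= -{1}[i]add0n big_addn big_mkord.
rewrite subSn ?(ltnW ij) //; apply: eq_bigr => u _.
rewrite addnC natrD (natrB _ (ltnW ij)); congr ((_ - (_ + _)) ^+ 2).
by rewrite [i%:R + _]addrC addrK mulrAC mulrA.
Qed.

Definition fit_segment (x : seq R) (i j : nat) : segment R :=
  let f u := point x (i + u) in
  let n := (j - i).+1 in
  ((i, intercept f n), (j, intercept f n + slope f n * (j - i)%:R)).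

Lemma sq_error_fit (x : seq R) (i j : nat) : (i < j)%N ->
  let f u := point x (i + u) in
  let n := (j - i).+1 in
  sq_error x (fit_segment x i j) =
    sum_yy f n - intercept f n * sum_y f n - slope f n * sum_uy f n.
Proof.
move=> ij f n; rewrite sq_errorE // addrC addKr mulfK ?residual_fit //.
  lia.
by rewrite pnatr_eq0; lia.
Qed.

(** A competitor over the same range is a line with its own intercept and slope, so [residual_min]
    applies. *)
Lemma least_squares_fit (x : seq R) (i j : nat) : (i < j)%N ->
  least_squares x i j (fit_segment x i j).
Proof.
move=> ij; split=> // -[[i' yi] [j' yj]] [-> ->].
rewrite !sq_errorE // addrC addKr mulfK; last by rewrite pnatr_eq0; lia.
by apply: residual_min; lia.
Qed.

End Fit.

(** * The program *)

(* Cells: 0 eps; 1 i; 2 j; 3-6 s; 7-11 the sums of u, u^2, x, u x, x^2 over the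
   points already read since x_i; 12 the last point read; 13 the constant 1;
   14 j - i; 15 the number of points; 16 determinant of the normal equations;
   17 x_(i+1); 18 slope; 19 intercept; 20 error; 18, 19, 21 also scratch. *)
Definition segment_bound : program := [::
  Const 13 1; Read 12 60; Const 1 1; Read 17 60;
  (* 4: x_i and x_(i+1) are in cells 12 and 17 *)
  Copy 3 1; Copy 4 12; Add 5 1 13; Copy 6 17; Add 2 5 13;
  Copy 7 13; Copy 8 13; Add 9 12 17; Copy 10 17;
  Mul 11 12 12; Mul 18 17 17; Add 11 11 18;
  (* 16: "Repeat" *)
  Read 12 56; Defs.Sub 14 2 1; Add 15 14 13; Add 7 7 14;
  Mul 18 14 14; Add 8 8 18;
  Add 9 9 12; Mul 18 14 12; Add 10 10 18; Mul 18 12 12; Add 11 11 18;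
  Mul 16 15 8; Mul 18 7 7; Defs.Sub 16 16 18;
  Mul 18 15 10; Mul 19 7 9; Defs.Sub 18 18 19; Div 18 18 16;
  Mul 19 18 7; Defs.Sub 19 9 19; Div 19 19 15;
  Mul 20 19 9; Defs.Sub 20 11 20; Mul 21 18 10; Defs.Sub 20 20 21;
  JumpLe 20 0 49;
  (* 42: reject *)
  Write 3; Write 4; Write 5; Write 6; Read 17 60; Copy 1 2; Jump 4;
  (* 49: accept *)
  Copy 3 1; Copy 4 19; Copy 5 2; Mul 18 18 14; Add 6 19 18; Add 2 2 13; Jump 16;
  (* 56: end of the input *)
  Write 3; Write 4; Write 5; Write 6; Halt ].

Definition sb_layout : layout := Layout 16 1 2 [tuple 3; 4; 5; 6]%N.

(** * Symbolic execution of the program and its loop invariant *)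

Section Correctness.
Variable R : realType.
Implicit Types (m : nat -> R) (w o x : seq R) (c : config R) (eps : R).

Inductive steps (P : program) : nat -> config R -> config R -> Prop :=
| steps0 c : steps P 0 c c
| stepsS k c c1 c2 :
    step P c = Some c1 -> steps P k c1 c2 -> steps P k.+1 c c2.

Lemma run_steps P eps x u k c c' :
  run P eps x u = Some c -> steps P k c c' -> run P eps x (u + k) = Some c'.
Proof.
move=> ru st; elim: st u ru => {k c c'} [c|k c c1 c2 s1 _ IH] u ru.
  by rewrite addn0.
by rewrite addnS -addSn; apply: IH; rewrite /run iterS -/(run P eps x u) ru.
Qed.

(** Each [Write] appends one real, while [encode_output] appends four per segment. *)
Lemma cat_seq4 (T : Type) (r : seq T) (a b c d : T) :
  r ++ [:: a; b; c; d] = rcons (rcons (rcons (rcons r a) b) c) d.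
Proof. by rewrite -!cats1 -!catA. Qed.

Arguments upd {R} m a v b /.

Local Ltac exec1 :=
  eapply stepsS; [rewrite /step /= /assign /goto /=; reflexivity | ].

Local Notation "m $ k" := (m k%N) (at level 2, k at level 1, only parsing).

(** Cells 7 to 11 receive the five sums over two points, at offsets 0 and 1. Symbolic execution
    itself builds the witness [m']. *)
Lemma exec_setup m w o : exists m',
  [/\ steps segment_bound 12 (Config 4 m w o) (Config 16 m' w o),
      [/\ m'$0 = m$0, m'$13 = m$13, m'$1 = m$1 & m'$2 = m$1 + m$13 + m$13],
      [:: m'$3; m'$4; m'$5; m'$6] = [:: m$1; m$12; m$1 + m$13; m$17]
    & [/\ m'$7 = m$13, m'$8 = m$13, m'$9 = m$12 + m$17, m'$10 = m$17
        & m'$11 = m$12 * m$12 + m$17 * m$17]].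
Proof. by eexists; split; first by do 12 exec1; exact: steps0. Qed.

(** The two hypotheses are exactly what keeps the two [Div] instructions from getting stuck. Stating
    the results through [m'] gives them the shape of [slope] and [intercept]. *)
Lemma exec_fit m v w o (l := m$2 - m$1) (n := l + m$13) :
  n != 0 -> n * (m$8 + l * l) - (m$7 + l) * (m$7 + l) != 0 ->
  exists m',
  [/\ steps segment_bound 25 (Config 16 m (v :: w) o) (Config 41 m' w o),
      [/\ m'$0 = m$0, m'$13 = m$13, m'$1 = m$1 & m'$2 = m$2],
      [:: m'$3; m'$4; m'$5; m'$6] = [:: m$3; m$4; m$5; m$6],
      [/\ m'$7 = m$7 + l, m'$8 = m$8 + l * l, m'$9 = m$9 + v,
          m'$10 = m$10 + l * v & m'$11 = m$11 + v * v]
    & [/\ m'$12 = v, m'$14 = l,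
          m'$18 = (n * m'$10 - m'$7 * m'$9) / (n * m'$8 - m'$7 * m'$7),
          m'$19 = (m'$9 - m'$18 * m'$7) / n
        & m'$20 = m'$11 - m'$19 * m'$9 - m'$18 * m'$10]].
Proof.
move=> n0 D0; eexists; split.
  do 17 exec1.
  eapply stepsS; first by rewrite /step /= (negbTE D0) /assign /=; reflexivity.
  do 2 exec1.
  eapply stepsS; first by rewrite /step /= (negbTE n0) /assign /=; reflexivity.
  do 4 exec1; exact: steps0.
all: by [].
Qed.

Lemma exec_accept m w o : m$20 <= m$0 -> exists m',
  [/\ steps segment_bound 8 (Config 41 m w o) (Config 16 m' w o),
      [/\ m'$0 = m$0, m'$13 = m$13, m'$1 = m$1 & m'$2 = m$2 + m$13],
      [:: m'$3; m'$4; m'$5; m'$6] = [:: m$1; m$19; m$2; m$19 + m$18 * m$14]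
    & [/\ m'$7 = m$7, m'$8 = m$8, m'$9 = m$9, m'$10 = m$10 & m'$11 = m$11]].
Proof.
move=> le_eps; eexists; split.
  eapply stepsS; first by rewrite /step /= le_eps /goto /=; reflexivity.
  do 7 exec1; exact: steps0.
all: by [].
Qed.

(** The block stops before [Read 17 60], whose outcome depends on whether a further point exists. *)
Lemma exec_write_reject m w o : ~~ (m$20 <= m$0) ->
  steps segment_bound 5 (Config 41 m w o)
    (Config 46 m w (o ++ [:: m$3; m$4; m$5; m$6])).
Proof.
rewrite cat_seq4 => gt_eps.
eapply stepsS.
  by rewrite /step /= (negbTE gt_eps) /goto /=; reflexivity.
by do 4 exec1; exact: steps0.
Qed.

(** The rejected point, still in cell 12, starts the new segment, so only one more point is read
    before the set-up code is reused. *)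
Lemma exec_restart m v w o : exists m',
  [/\ steps segment_bound 15 (Config 46 m (v :: w) o) (Config 16 m' w o),
      [/\ m'$0 = m$0, m'$13 = m$13, m'$1 = m$2 & m'$2 = m$2 + m$13 + m$13],
      [:: m'$3; m'$4; m'$5; m'$6] = [:: m$2; m$12; m$2 + m$13; v]
    & [/\ m'$7 = m$13, m'$8 = m$13, m'$9 = m$12 + v, m'$10 = v
        & m'$11 = m$12 * m$12 + v * v]].
Proof.
have [m' [st Hc Hs Hsum]] := exec_setup (upd (upd m 17 v) 1 (m$2)) w o.
exists m'; split; first by do 3 exec1; exact: st.
- exact: Hc.
- exact: Hs.
- exact: Hsum.
Qed.

Lemma exec_end m o :
  steps segment_bound 5 (Config 16 m [::] o)
    (Config 60 m [::] (o ++ [:: m$3; m$4; m$5; m$6])).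
Proof. by rewrite cat_seq4; do 5 exec1; exact: steps0. Qed.

(** The point [x_j] is still unread, and the sums cover [x_i, ..., x_(j-1)]. Cells 12 and 14 to 21
    are unconstrained because they are overwritten before being used again. *)
Record loop_inv x eps (i j : nat) (s : segment R) (out : seq (segment R)) c :
    Prop := LoopInv {
  inv_le : (i + 2 <= j)%N;
  inv_input : inp c = drop j.-1 x;
  inv_size : (j.-1 <= size x)%N;
  inv_pc : pc c = 16%N;
  inv_eps : (Defs.mem c)$0 = eps;
  inv_one : (Defs.mem c)$13 = 1;
  inv_i : (Defs.mem c)$1 = i%:R;
  inv_j : (Defs.mem c)$2 = j%:R;
  inv_s : [:: (Defs.mem c)$3; (Defs.mem c)$4; (Defs.mem c)$5; (Defs.mem c)$6]
    = encode s;
  inv_out : outp c = encode_output out;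
  inv_su : (Defs.mem c)$7 = sum_u R (j - i);
  inv_suu : (Defs.mem c)$8 = sum_uu R (j - i);
  inv_sy : (Defs.mem c)$9 = sum_y (fun u => point x (i + u)) (j - i);
  inv_suy : (Defs.mem c)$10 = sum_uy (fun u => point x (i + u)) (j - i);
  inv_syy : (Defs.mem c)$11 = sum_yy (fun u => point x (i + u)) (j - i) }.

Lemma inv_represents x eps i j s out c : loop_inv x eps i j s out c ->
  represents sb_layout c (SBState i j s out).
Proof. by case=> *; split. Qed.

Lemma encode_output_rcons (out : seq (segment R)) s :
  encode_output (rcons out s) = encode_output out ++ encode s.
Proof. by rewrite /encode_output map_rcons flatten_rcons. Qed.

(** Serves both the first entry into the loop and every restart after a rejection. *)
Lemma loop_inv_two_points x eps j out m w (y := point x j) (z := point x j.+1) :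
  w = drop j.+1 x -> (j.+1 <= size x)%N ->
  [/\ m$0 = eps, m$13 = 1, m$1 = j%:R & m$2 = j%:R + 1 + 1] ->
  [:: m$3; m$4; m$5; m$6] = [:: j%:R; y; j%:R + 1; z] ->
  [/\ m$7 = 1, m$8 = 1, m$9 = y + z, m$10 = z & m$11 = y * y + z * z] ->
  loop_inv x eps j j.+2 (two_points x j) out
    (Config 16 m w (encode_output out)).
Proof.
move=> -> sz [e0 e13 e1 e2] es [e7 e8 e9 e10 e11].
have jj : (j.+2 - j = 2)%N by lia.
split=> //=; rewrite ?jj.
- by lia.
- by rewrite e2 !natr1.
- by rewrite es /encode /= natr1.
- by rewrite e7 /sum_u !big_ord_recr big_ord0 /= !add0r.
- by rewrite e8 /sum_uu !big_ord_recr big_ord0 /= mulr0 mulr1 !add0r.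
- by rewrite e9 /sum_y !big_ord_recr big_ord0 /= add0r addn0 addn1.
- by rewrite e10 /sum_uy !big_ord_recr big_ord0 /= mul0r mul1r !add0r addn1.
- by rewrite e11 /sum_yy !big_ord_recr big_ord0 /= add0r addn0 addn1.
Qed.

Lemma fit_block x eps i j s out c : loop_inv x eps i j s out c ->
  (j <= size x)%N -> exists m,
  [/\ steps segment_bound 25 c
        (Config 41 m (drop j x) (encode_output out)),
      [/\ m$0 = eps, m$13 = 1, m$1 = i%:R & m$2 = j%:R],
      [:: m$3; m$4; m$5; m$6] = encode s,
      [/\ m$7 = sum_u R (j.+1 - i), m$8 = sum_uu R (j.+1 - i),
          m$9 = sum_y (fun u => point x (i + u)) (j.+1 - i),
          m$10 = sum_uy (fun u => point x (i + u)) (j.+1 - i)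
        & m$11 = sum_yy (fun u => point x (i + u)) (j.+1 - i)]
    & [/\ m$12 = point x j, m$20 = sq_error x (fit_segment x i j)
        & [:: m$1; m$19; m$2; m$19 + m$18 * m$14] =
          encode (fit_segment x i j)]].
Proof.
case: c => p m w o [/= ij -> sz -> <- e13 e1 e2 es -> e7 e8 e9 e10 e11] jx.
have ij1 : (i < j)%N by lia.
(* Points are numbered from 1, so [x_j] sits at list index [j.-1]. *)
have -> : drop j.-1 x = point x j :: drop j x.
  by rewrite (drop_nth 0) ?prednK //; lia.
have el : m$2 - m$1 = (j - i)%:R by rewrite e1 e2 natrB // ltnW.
have en : m$2 - m$1 + m$13 = (j - i).+1%:R by rewrite el e13 natr1.
have eu : sum_u R (j - i).+1 = m$7 + (m$2 - m$1).
  by rewrite /sum_u big_ord_recr /= el e7.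
have euu : sum_uu R (j - i).+1 = m$8 + (m$2 - m$1) * (m$2 - m$1).
  by rewrite /sum_uu big_ord_recr /= el e8.
set f := fun u => point x (i + u) in e9 e10 e11 *.
have ef : f (j - i)%N = point x j by rewrite /f subnKC // ltnW.
have [] := @exec_fit m (point x j) (drop j x) (encode_output out).
- by rewrite en pnatr_eq0.
- by rewrite -eu -euu en; apply: fit_det_neq0; lia.
move=> m' [st [d0 d13 d1 d2] ds [d7 d8 d9 d10 d11] [d12 d14 d18 d19 d20]].
rewrite -eu in d7; rewrite -euu in d8; rewrite en in d18 d19; rewrite el in d14.
have {}d9 : m'$9 = sum_y f (j - i).+1.
  by rewrite d9 /sum_y big_ord_recr /= ef e9.
have {}d10 : m'$10 = sum_uy f (j - i).+1.
  by rewrite d10 /sum_uy big_ord_recr /= ef e10 el.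
have {}d11 : m'$11 = sum_yy f (j - i).+1.
  by rewrite d11 /sum_yy big_ord_recr /= ef e11.
have {}d18 : m'$18 = slope f (j - i).+1 by rewrite d18 d7 d8 d9 d10.
have {}d19 : m'$19 = intercept f (j - i).+1 by rewrite d19 d18 d7 d9.
have {}d20 : m'$20 = sq_error x (fit_segment x i j).
  by rewrite d20 d19 d18 d9 d10 d11 -(sq_error_fit x ij1).
exists m'; rewrite (subSn (ltnW ij1)); split.
- exact: st.
- by rewrite d0 d13 d1 d2.
- by rewrite ds.
- by split.
- by split=> //; rewrite d1 d2 d14 d18 d19 e1 e2.
Qed.

(* A rejecting iteration, the longest: 25 steps for the fit, 5 for the output
   and 15 for the restart. *)
Definition iteration_cost : nat := 45.

(** Induction on the number of unread points. It is strong because a rejection consumes two of them.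
    The additive [iteration_cost] pays for the last, incomplete iteration. *)
Lemma loop_correct x eps k i j s out c u :
  (size x - j.-1 <= k)%N -> loop_inv x eps i j s out c ->
  run segment_bound eps x u = Some c ->
  exists tr final ts t d,
    [/\ sb_from x eps (SBState i j s out) tr final, path ltn u ts,
        List.Forall2 (fun v st => exists2 e,
          run segment_bound eps x v = Some e & represents sb_layout e st)
          (u :: ts) tr,
        halts_at segment_bound eps x t d
      & outp d = encode_output final /\
        (t <= u + iteration_cost * (size x - j.-1) + iteration_cost)%N].
Proof.
elim/ltn_ind: k i j s out c u => k IHk i j s out c u lek inv ru.
have rep := inv_represents inv.
have here : exists2 e, run segment_bound eps x u = Some e &
    represents sb_layout e (SBState i j s out) by exists c.
have ij := inv_le inv; have sz := inv_size inv.
have [xj | jx] := ltnP (size x) j.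
  have Ec : c = Config 16 (Defs.mem c) [::] (encode_output out).
    case: c inv {ru rep here} => p m w o [/= _ -> _ -> _ _ _ _ _ -> _ _ _ _ _].
    by rewrite drop_oversize //; lia.
  rewrite Ec in ru; have ru' := run_steps ru (exec_end _ _).
  eexists _, _, [::], (u + 5)%N, _; split; last 2 first.
  - by split; first exact: ru'.
  - split; last by rewrite /iteration_cost; lia.
    by rewrite /= (inv_s inv) -encode_output_rcons.
  - exact: sb_end.
  - by [].
  - by constructor.
have [m [st [e0 e13 e1 e2] es [e7 e8 e9 e10 e11] [e12 e20 efit]]] :=
  fit_block inv jx.
have ru1 := run_steps ru st.
have ls : least_squares x i j (fit_segment x i j).
  by apply: least_squares_fit; lia.
have [acc | rej] := boolP (m$20 <= m$0).
  have [m' [st' [d0 d13 d1 d2] ds [d7 d8 d9 d10 d11]]] :=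
    exec_accept (drop j x) (encode_output out) acc.
  have ru2 := run_steps ru1 st'.
  have inv' : loop_inv x eps i j.+1 (fit_segment x i j) out
      (Config 16 m' (drop j x) (encode_output out)).
    split=> //=.
    - by lia.
    - by rewrite d0.
    - by rewrite d13.
    - by rewrite d1.
    - by rewrite d2 e2 e13 natr1.
    - by rewrite ds.
    - by rewrite d7.
    - by rewrite d8.
    - by rewrite d9.
    - by rewrite d10.
    - by rewrite d11.
  have ltk : (size x - j < k)%N by lia.
  have [tr [final [ts [t [d [sb pts fts halt [eo let_]]]]]]] :=
    IHk _ ltk i j.+1 _ _ _ _ (leqnn _) inv' ru2.
  exists (SBState i j s out :: tr), final, (u + 25 + 8 :: ts)%N, t, d.
  split=> //.
  - by apply: sb_accept sb => //; rewrite -e20 -e0.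
  - by rewrite /= pts andbT; lia.
  - by constructor.
  - by split=> //; move: let_; rewrite /iteration_cost /=; lia.
have ru2 := run_steps ru1 (exec_write_reject _ _ rej).
rewrite es -encode_output_rcons in ru2.
have rej' : ~ sq_error x (fit_segment x i j) <= eps.
  by rewrite -e20 -e0; apply/negP.
(* If the rejected point is the last one, [s] is already written and one failing [Read] leads to
   [Halt]: this is [sb_reject_last]. *)
have [xj | jx1] := leqP (size x) j.
  have Ej : j = size x by lia.
  eexists _, _, [::], (u + 25 + 5 + 1)%N, _; split; last 2 first.
  - split; first apply: (run_steps ru2).
      by rewrite Ej drop_size; exec1; exact: steps0.
    by [].
  - by split; last by rewrite /iteration_cost; lia.
  - exact: sb_reject_last rej'.
  - by [].
  - by constructor.
have [m' [st' [d0 d13 d1 d2] ds dsum]] :=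
  exec_restart m (point x j.+1) (drop j.+1 x) (encode_output (rcons out s)).
rewrite e2 e12 e13 in d2 ds dsum.
rewrite (drop_nth 0) // in ru2; have ru3 := run_steps ru2 st'.
have inv' : loop_inv x eps j j.+2 (two_points x j) (rcons out s)
    (Config 16 m' (drop j.+1 x) (encode_output (rcons out s))).
  by apply: loop_inv_two_points => //; rewrite d0 d13 d1 d2.
have ltk : (size x - j.+1 < k)%N by lia.
have [tr [final [ts [t [d [sb pts fts halt [eo let_]]]]]]] :=
  IHk _ ltk j j.+2 _ _ _ _ (leqnn _) inv' ru3.
exists (SBState i j s out :: tr), final, (u + 25 + 5 + 15 :: ts)%N, t, d.
split=> //.
- exact: sb_reject jx1 ls rej' sb.
- by rewrite /= pts andbT; lia.
- by constructor.
- by split=> //; move: let_; rewrite /iteration_cost /=; lia.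
Qed.

Lemma segment_bound_correct x eps :
  exists tr final ts t d,
    [/\ sb_execution x eps tr final, sorted ltn ts,
        List.Forall2 (fun v st => exists2 e,
          run segment_bound eps x v = Some e & represents sb_layout e st) ts tr,
        halts_at segment_bound eps x t d
      & outp d = encode_output final /\
        (t <= iteration_cost * size x + iteration_cost)%N].
Proof.
case: x => [|y [|z x]].
(* With fewer than two points a [Read] of the set-up jumps straight to [Halt], after 2 or 4
   steps. *)
- exists [::], [::], [::], 2%N.
  exists (Config 60 (upd (upd (fun=> 0) 0 eps) 13 1) [::] [::]).
  by split=> //; exact: sb_short.
- exists [::], [::], [::], 4%N.
  exists (Config 60
    (upd (upd (upd (upd (fun=> 0) 0 eps) 13 1) 12 y) 1 1) [::] [::]).
  by split=> //; exact: sb_short.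
pose m0 : nat -> R :=
  upd (upd (upd (upd (upd (fun=> 0) 0 eps) 13 1) 12 y) 1 1) 17 z.
have st0 : steps segment_bound 4 (initial eps [:: y, z & x])
    (Config 4 m0 x [::]).
  by do 4 exec1; exact: steps0.
have [m [st Hc Hs Hsum]] := exec_setup m0 x [::].
(* These 16 steps are covered by the two points already read, which the loop bound does not
   charge. *)
have [u [ru leu]] : exists u, run segment_bound eps [:: y, z & x] u =
    Some (Config 16 m x [::]) /\ (u <= 16)%N.
  exists (0 + 4 + 12)%N; split=> //.
  by apply: run_steps st; apply: run_steps st0.
have inv : loop_inv [:: y, z & x] eps 1 3 (two_points [:: y, z & x] 1) [::]
    (Config 16 m x (encode_output [::])).
  by apply: loop_inv_two_points; rewrite //= drop0.
have [tr [final [ts [t [d [sb pts fts halt [eo let_]]]]]]] :=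
  loop_correct (leqnn _) inv ru.
exists tr, final, (u :: ts), t, d; split=> //.
- exact: sb_start.
- by split=> //; move: let_; rewrite /iteration_cost /=; lia.
Qed.

(** * Space bound *)

Lemma accessed_lt22 c : all (ltn^~ 22)%N (accessed segment_bound c).
Proof.
case: c => p m w o; rewrite /accessed /fetch.
(* No instruction addresses indirectly, so the cells accessed depend only on which of the 61
   instructions is current. *)
by do 61 (case: p => [//|p]); case: p.
Qed.

Lemma space_segment_bound eps x t : (Defs.space segment_bound eps x t <= 22)%N.
Proof.
rewrite /Defs.space -[leqRHS](size_iota 0).
apply: uniq_leq_size; first exact: undup_uniq.
move=> a; rewrite mem_undup => /flattenP[l /mapP[k _ ->]].
rewrite mem_iota add0n /=; case: run => //= c.
exact: (allP (accessed_lt22 c)).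
Qed.

End Correctness.

Theorem theorem2 (R : realType) :
  exists P : program,
    [/\ implements_SegmentBound R P,
        time_O R P (fun n => n)
      & space_O R P (fun=> 1%N)].
Proof.
exists segment_bound; split.
- exists sb_layout => x eps.
  have [tr [final [ts [t [d [sb pts fts halt [eo _]]]]]]] :=
    segment_bound_correct x eps.
  by exists tr, final; split=> //; exists ts, t, d.
(* For [n] at least 1, doubling the constant absorbs the additive term. *)
- exists (2 * iteration_cost)%N, 1%N => n eps x n_gt0 szx.
  have [_ [_ [_ [t [d [_ _ _ halt [_ let_]]]]]]] := segment_bound_correct x eps.
  by exists t, d; split=> //; move: let_; rewrite szx /iteration_cost; lia.
- exists 22%N, 0%N => n eps x _ _.
  have [_ [_ [_ [t [d [_ _ _ halt _]]]]]] := segment_bound_correct x eps.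
  by exists t, d; split=> //; exact: space_segment_bound.
Qed.
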